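(* Let $X$ be a $T_0$ asymmetric locally convex space with dual space $X^*$ and set $\mathcal G=\{H\subseteq X^*: H\text{ is equicontinuous}\}$. Then the $\mathcal G$-topology on $X$ coincides with the original topology of $X$.
   Context: All vector spaces and cones are over the reals. An asymmetric seminorm on a vector space $X$ is a function $p:X\to[0,\infty)$ with $p(rx)=rp(x)$ for $r\ge 0$ and $p(x+y)\le p(x)+p(y)$. A family $\mathcal P$ of asymmetric seminorms on $X$ induces the topology with basis the sets $\{y\in X: p(y-x)<\epsilon\ \forall p\in F\}$, for $x\in X$, $\epsilon>0$, $F\subseteq\mathcal P$ finite. A vector space with such a topology is an asymmetric locally convex space. Its dual space $X^*$ is the cone of all linear, upper semicontinuous functions $X\to\mathbb R$. A subset $H\subseteq X^*$ is equicontinuous if for each $\epsilon>0$ there is a neighbourhood $U\subseteq X$ of the origin such that $\phi(x)<\epsilon$ for all $\phi\in H$ and $x\in U$. For a collection $\mathcal G$ of subsets of $X^*$, the $\mathcal G$-topology on $X$ is the topology induced by the functions $p_G(x)=\sup_{\phi\in G}\max\{\phi(x),0\}$, $G\in\mathcal G$, provided they are asymmetric seminorms (i.e. finite-valued); that this is the case for the given $\mathcal G$ is part of the assertion. *)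

(* Defs.v *)
From HB Require Import structures.
From mathcomp Require Import all_boot all_order all_algebra.
From mathcomp Require Import all_classical all_reals all_analysis.

Set Implicit Arguments.
Unset Strict Implicit.
Unset Printing Implicit Defensive.

Import Order.TTheory GRing.Theory Num.Theory.
Import numFieldNormedType.Exports.

Local Open Scope classical_set_scope.
Local Open Scope ring_scope.

Section AsymmetricSeminorms.
Context {R : realType} {X : lmodType R}.
Implicit Types (p : X -> R) (P F : set (X -> R)).

Definition asym_seminorm p : Prop :=
  [/\ forall x, 0 <= p x,
      forall (r : R) x, 0 <= r -> p (r *: x) = r * p x
    & forall x y, p (x + y) <= p x + p y].

Definition asym_ball F (e : R) (x : X) : set X :=
  [set y | forall p, F p -> p (y - x) < e].

Definition asym_basis P : set (set X) :=
  [set B | exists F e x,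
     [/\ finite_set F, F `<=` P, 0 < e & B = asym_ball F e x]].

(* Open sets of the topology induced by P: the unions of basic sets. *)
Definition induced_open P : set (set X) :=
  [set \bigcup_(B in D) B | D in [set D | D `<=` asym_basis P]].

End AsymmetricSeminorms.

(* The topology of X is the one bundled in [preTopologicalLmodType], which
   imposes no compatibility between the topology and the linear structure:
   in an asymmetric space, negation need not be continuous. *)
Definition asym_locally_convex (R : realType) (X : preTopologicalLmodType R) :
    Prop :=
  exists2 P : set (X -> R), P `<=` asym_seminorm & @open X = induced_open P.

Definition upper_semicontinuous (R : realType) (T : topologicalType)
    (f : T -> R) : Prop :=
  forall x (a : R), f x < a -> \forall y \near x, f y < a.

Section Dual.
Context {R : realType} (X : preTopologicalLmodType R).

Definition asym_dual : set {scalar X} :=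
  [set phi | upper_semicontinuous (phi : X -> R)].

(* One-sided (phi x < e rather than `|phi x| < e), hence distinct from the
   uniform-space notion [equicontinuous]. *)
Definition asym_equicontinuous (H : set {scalar X}) : Prop :=
  forall e : R, 0 < e -> exists2 U : set X, nbhs (0 : X) U &
    forall phi x, H phi -> U x -> phi x < e.

Definition equicontinuous_sets : set (set {scalar X}) :=
  [set H | H `<=` asym_dual /\ asym_equicontinuous H].

End Dual.

Arguments asym_dual {R} X _.
Arguments equicontinuous_sets {R} X _.

Section GTopology.
Context {R : realType} {X : lmodType R}.

(* The supremum is taken in [0, +oo]: adjoining 0 only matters for the empty
   set G, where it gives 0 instead of -oo. *)
Definition sup_seminorm (G : set {scalar X}) (x : X) : \bar R :=
  ereal_sup (0%E |` [set (Num.max (phi x) 0)%:E | phi in G]).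

(* [fine] is only meaningful when all the sup_seminorm G are finite-valued. *)
Definition G_open (GG : set (set {scalar X})) : set (set X) :=
  induced_open [set (fun x => fine (sup_seminorm G x)) | G in GG].

End GTopology.

(* Main.v *)
From HB Require Import structures.
Require Import Defs.
From mathcomp Require Import all_boot all_order all_algebra.
From mathcomp Require Import all_classical all_reals all_analysis.
From mathcomp Require Import lra.

(** The theorem is a polarity argument resting on the Hahn-Banach theorem.

    An equicontinuous set [G] is bounded by [1] on some neighbourhood of the
    origin. Neighbourhoods of the origin are absorbing ([nbhs0_absorbing]), so
    the supremum over [G] is finite at every point, and a finite supremum of
    linear functionals, truncated at [0], is an asymmetric seminorm. Applied to
    every [e > 0] and combined with translation invariance of the topology, the
    same bound makes the balls of this seminorm open, so the topology induced by
    the equicontinuous sets is coarser than the original one.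

    Conversely, let [p] be one of the seminorms that define the topology, and
    take the set of all linear functionals dominated by [p]. It is an
    equicontinuous subset of the dual ([support_equicontinuous]), and by
    Hahn-Banach its supremum is [p] itself ([sup_seminorm_support]). Thus every
    defining seminorm is among those of the equicontinuous sets, and the
    topology they induce is finer than the original one.

    Hahn-Banach is proved here in the form [sublinear_support]: every sublinear
    [p] has, at each point, a supporting linear functional. The route avoids
    extending functionals from subspaces: Zorn's lemma gives a minimal sublinear
    functional below [p], and minimal sublinear functionals are linear. *)

Set Implicit Arguments.
Unset Strict Implicit.
Unset Printing Implicit Defensive.

Import Order.TTheory GRing.Theory Num.Theory.

Local Open Scope classical_set_scope.
Local Open Scope ring_scope.

(** * Sublinear functionals and the Hahn-Banach theorem *)

Section Sublinear.
Context {R : realType} {X : lmodType R}.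
Implicit Types (p q : X -> R) (x y : X).

(** Only one inequality is required, for scalars [r > 0]: applied to [r^-1] it
    gives the reverse one, and [q 0 = 0] follows from [r = 2]. This keeps the
    closure of the notion under infima short. *)
Definition sublinear q : Prop :=
  (forall (r : R) x, 0 < r -> q (r *: x) <= r * q x) /\
  (forall x y, q (x + y) <= q x + q y).

Lemma sublinear0 q : sublinear q -> q 0 = 0.
Proof.
move=> [qZ qD]; have := qD 0 0; have := qZ 2^-1 0.
by rewrite scaler0 addr0 invr_gt0 ltr0n => /(_ isT); lra.
Qed.

Lemma sublinearZ q (r : R) x : sublinear q -> 0 <= r -> q (r *: x) = r * q x.
Proof.
move=> ql; rewrite le_eqVlt => /predU1P[<-|r0].
  by rewrite scale0r mul0r sublinear0.
apply/eqP; rewrite eq_le ql.1//= -ler_pdivlMl//.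
have := ql.1 r^-1 (r *: x); rewrite invr_gt0 => /(_ r0).
by rewrite scalerA mulVf ?gt_eqF// scale1r.
Qed.

Lemma sublinear_opp_ge q x : sublinear q -> - q (- x) <= q x.
Proof.
move=> ql; have := ql.2 x (- x); rewrite subrr sublinear0//; lra.
Qed.

Lemma asym_seminorm_sublinear p : asym_seminorm p -> sublinear p.
Proof. by case=> p0 pZ pD; split => // r x r0; rewrite pZ// ltW. Qed.

(** Common source of the two infima used below: the infimum of a chain of
    sublinear functionals, and the lowering of one functional along a ray. *)
Lemma inf_sublinear (S : X -> set R) :
  (forall x, S x !=set0) -> (forall x, has_lbound (S x)) ->
  (forall r x s, 0 < r -> S x s -> exists2 t, S (r *: x) t & t <= r * s) ->
  (forall x y s t, S x s -> S y t -> exists2 u, S (x + y) u & u <= s + t) ->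
  sublinear (fun x => inf (S x)).
Proof.
move=> S0 Slb SZ SD; split=> [r x r0|x y] /=.
- rewrite -ler_pdivrMl//; apply: lb_le_inf => // s /(SZ r _ _ r0)[t St ts].
  by rewrite ler_pdivrMl//; apply: le_trans ts; exact: ge_inf.
- rewrite -lerBlDr; apply: lb_le_inf => // s Ss.
  rewrite lerBlDr -lerBlDl; apply: lb_le_inf => // t St.
  rewrite lerBlDl; have [u Su ust] := SD _ _ _ _ Ss St.
  by apply: le_trans ust; exact: ge_inf.
Qed.

(** Zorn's lemma for the reverse pointwise order. The bound [- q (- x)] on
    every [q x] makes the pointwise infimum of a chain finite, and adjoining
    [p] covers the empty chain. *)
Lemma ex_minimal_sublinear p : sublinear p ->
  exists q, [/\ sublinear q, forall x, q x <= p x &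
    forall q', sublinear q' -> (forall x, q' x <= q x) ->
    forall x, q x <= q' x].
Proof.
move=> pl; pose T := {q | sublinear q /\ forall x, q x <= p x}.
pose le (s t : T) := `[< forall x, sval t x <= sval s x >].
have [|||q qmin] := @ZL_preorder T (exist _ p (conj pl (fun=> lexx _))) le.
- by move=> t; apply/asboolP.
- move=> r s t /asboolP rs /asboolP st; apply/asboolP => x.
  exact: le_trans (st x) (rs x).
- move=> A Atot; pose Q := p |` [set sval s | s in A].
  have Qtot q q' : Q q -> Q q' ->
      (forall x, q x <= q' x) \/ (forall x, q' x <= q x).
    move=> [->|[s As <-]] [->|[t At <-]].
    + by left.
    + by right; apply: (svalP t).2.
    + by left; apply: (svalP s).2.
    + by have [/asboolP|/asboolP] := Atot _ _ As At; [right|left].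
  have Ql q : Q q -> sublinear q by move=> [->//|[s _ <-]]; exact: (svalP s).1.
  have Qp q : Q q -> forall x, q x <= p x.
    by move=> [->//|[s _ <-]]; exact: (svalP s).2.
  pose S x := [set q x | q in Q].
  have Slb x : has_lbound (S x).
    exists (- p (- x)) => _ [q Qq <-].
    by apply: le_trans (sublinear_opp_ge _ (Ql _ Qq)); rewrite lerN2 Qp.
  have Sl : sublinear (fun x => inf (S x)).
    apply: inf_sublinear => //.
    + by move=> x; exists (p x), p => //; left.
    + move=> r x _ r0 [q Qq <-]; exists (q (r *: x)); first by exists q.
      exact: (Ql _ Qq).1.
    + move=> x y _ _ [q Qq <-] [q' Qq' <-].
      have [qq'|q'q] := Qtot _ _ Qq Qq'.
      * exists (q (x + y)); first by exists q.
        by apply: le_trans ((Ql _ Qq).2 _ _) _; rewrite lerD2l.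
      * exists (q' (x + y)); first by exists q'.
        by apply: le_trans ((Ql _ Qq').2 _ _) _; rewrite lerD2r.
  have SQ q x : Q q -> inf (S x) <= q x.
    by move=> Qq; apply: ge_inf => //; exists q.
  have Sp x : inf (S x) <= p x by apply: SQ; left.
  exists (exist _ (fun x => inf (S x)) (conj Sl Sp)) => s As.
  by apply/asboolP => x; apply: SQ; right; exists s.
exists (sval q); have [ql qp] := svalP q; split=> // q' q'l q'q x.
have q'p y : q' y <= p y by exact: le_trans (q'q y) (qp y).
have /asboolP := qmin (exist _ q' (conj q'l q'p)) (asboolT q'q).
exact.
Qed.

(** The functional [q'] is the infimum of [q (x + t *: y) - t * q y] over
    [t >= 0]. Lowering [q] along the ray of [y] forces additivity in the direction [y]:
    the value at [t = 1] yields [q' x <= q (x + y) - q y]. *)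
Lemma sublinear_lower q y : sublinear q ->
  exists q', [/\ sublinear q', forall x, q' x <= q x &
                 forall x, q' x + q y <= q (x + y)].
Proof.
move=> ql; pose S x := [set q (x + t *: y) - t * q y | t in [set t | 0 <= t]].
have Slb x : has_lbound (S x).
  exists (- q (- x)) => _ [t t0 <-].
  have := ql.2 (x + t *: y) (- x).
  by rewrite addrAC subrr add0r sublinearZ//; lra.
have Sle x t : 0 <= t -> inf (S x) <= q (x + t *: y) - t * q y.
  by move=> t0; apply: ge_inf => //; exists t.
exists (fun x => inf (S x)); split.
- apply: inf_sublinear => //.
  + by move=> x; exists (q (x + 0 *: y) - 0 * q y), 0 => /=.
  + move=> r x _ r0 [t /= t0 <-].
    exists (q (r *: x + (r * t) *: y) - (r * t) * q y).
      by exists (r * t) => //=; rewrite mulr_ge0// ltW.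
    by rewrite -scalerA -scalerDr (sublinearZ _ ql (ltW r0)) -mulrA mulrBr.
  + move=> x x' _ _ [t /= t0 <-] [t' /= t'0 <-].
    exists (q (x + x' + (t + t') *: y) - (t + t') * q y).
      by exists (t + t') => //=; rewrite addr_ge0.
    rewrite scalerDl addrACA; have := ql.2 (x + t *: y) (x' + t' *: y); lra.
- by move=> x; have := Sle x 0 (lexx 0); rewrite scale0r addr0 mul0r subr0.
- by move=> x; have := Sle x 1 ler01; rewrite scale1r mul1r; lra.
Qed.

Lemma additive_sublinear_scalar q : sublinear q ->
  (forall x y, q x + q y <= q (x + y)) -> exists phi : {scalar X}, q = phi.
Proof.
move=> ql qge.
have qD x y : q (x + y) = q x + q y by apply/eqP; rewrite eq_le ql.2 qge.
have qN x : q (- x) = - q x.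
  by have := qD x (- x); rewrite subrr sublinear0//; lra.
have qZ (r : R) x : q (r *: x) = r * q x.
  have [r0|/ltW r0] := leP 0 r; first exact: sublinearZ.
  by rewrite -[r]opprK scaleNr qN sublinearZ ?oppr_ge0// !mulNr.
have qlin : scalar q by move=> r x y; rewrite qD qZ.
pose phi : {scalar X} := HB.pack q (GRing.isLinear.Build _ _ _ _ q qlin).
by exists phi.
Qed.

(** Hahn-Banach. A minimal sublinear functional cannot be lowered, so it is
    additive by [sublinear_lower]. Lowering [p] along [x0] before minimizing
    makes the value at [- x0] at most [- p x0], which pins [phi x0]. *)
Lemma sublinear_support p x0 : sublinear p ->
  exists phi : {scalar X}, (forall x, phi x <= p x) /\ phi x0 = p x0.
Proof.
move=> pl; have [p' [p'l p'p p'x0]] := sublinear_lower x0 pl.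
have [q [ql qp' qmin]] := ex_minimal_sublinear p'l.
have [|phi qphi] := additive_sublinear_scalar ql.
  move=> x y; have [q' [q'l q'q q'y]] := sublinear_lower y ql.
  by apply: le_trans (q'y x); rewrite lerD2r; exact: qmin.
have phip x : phi x <= p x by rewrite -qphi; apply: le_trans (qp' x) (p'p x).
exists phi; split=> //; apply/eqP; rewrite eq_le phip/=.
have := qp' (- x0); rewrite qphi linearN.
by have := p'x0 (- x0); rewrite addNr sublinear0//; lra.
Qed.

End Sublinear.

(** * Suprema of sets of linear functionals *)

Section SupSeminorm.
Context {R : realType} {X : lmodType R}.
Implicit Types (G : set {scalar X}) (p : X -> R) (x : X).

Lemma sup_seminorm_le G x (a : R) : 0 <= a ->
  (forall phi, G phi -> phi x <= a) -> (sup_seminorm G x <= a%:E)%E.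
Proof.
move=> a0 Ga; apply: ge_ereal_sup => _ [->|[phi Gphi <-]]; rewrite lee_fin//.
by rewrite ge_max Ga.
Qed.

Lemma sup_seminorm_fin_num G x (a : R) : 0 <= a ->
  (forall phi, G phi -> phi x <= a) -> sup_seminorm G x \is a fin_num.
Proof.
move=> a0 Ga; rewrite ge0_fin_numE; last by apply: ereal_sup_ubound; left.
exact: le_lt_trans (sup_seminorm_le a0 Ga) (ltry _).
Qed.

Lemma fine_sup_seminorm_le G x (a : R) : 0 <= a ->
  (forall phi, G phi -> phi x <= a) -> fine (sup_seminorm G x) <= a.
Proof.
move=> a0 Ga; rewrite -lee_fin fineK ?sup_seminorm_le//.
exact: sup_seminorm_fin_num a0 Ga.
Qed.

Lemma fine_sup_seminorm_ge G x phi : sup_seminorm G x \is a fin_num ->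
  G phi -> phi x <= fine (sup_seminorm G x).
Proof.
move=> Gfin Gphi; rewrite -lee_fin fineK//.
apply: (@le_trans _ _ (Num.max (phi x) 0)%:E).
  by rewrite lee_fin le_max lexx.
by apply: ereal_sup_ubound; right; exists phi.
Qed.

Lemma fine_sup_seminorm_ge0 G x : 0 <= fine (sup_seminorm G x).
Proof. by rewrite fine_ge0//; apply: ereal_sup_ubound; left. Qed.

Lemma asym_seminorm_sup G : (forall x, sup_seminorm G x \is a fin_num) ->
  asym_seminorm (fun x => fine (sup_seminorm G x)).
Proof.
move=> Gfin; have pl : sublinear (fun x => fine (sup_seminorm G x)).
  split=> [r x r0|x y] /=; apply: fine_sup_seminorm_le.
  - by rewrite mulr_ge0 ?fine_sup_seminorm_ge0// ltW.
  - move=> phi Gphi; rewrite linearZ/= ler_pM2l//.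
    exact: fine_sup_seminorm_ge.
  - by rewrite addr_ge0 ?fine_sup_seminorm_ge0.
  - by move=> phi Gphi; rewrite linearD lerD// fine_sup_seminorm_ge.
split=> [x|r x r0|x y]; last exact: pl.2.
- exact: fine_sup_seminorm_ge0.
- exact: sublinearZ pl r0.
Qed.

(** By Hahn-Banach, an asymmetric seminorm is the supremum of the linear
    functionals that it dominates. *)
Lemma sup_seminorm_support p : asym_seminorm p ->
  (fun x => fine (sup_seminorm [set phi | forall x, phi x <= p x] x)) = p.
Proof.
move=> pS; have [p0 _ _] := pS; apply/funext => x.
apply/eqP; rewrite eq_le fine_sup_seminorm_le//=.
have [phi [phip <-]] := sublinear_support x (asym_seminorm_sublinear pS).
by apply: fine_sup_seminorm_ge => //; exact: (@sup_seminorm_fin_num _ _ (p x)).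
Qed.

End SupSeminorm.

(** * Topologies induced by asymmetric seminorms *)

Section InducedTopology.
Context {R : realType} (X : preTopologicalLmodType R).
Implicit Types (P Q : set (X -> R)) (G : set {scalar X}).

Lemma sub_induced_open P Q : P `<=` Q -> induced_open P `<=` induced_open Q.
Proof.
move=> PQ _ [D DP <-]; exists D => // B /DP[F [e [x [Ffin FP e0 ->]]]].
by exists F, e, x; split=> //; exact: subset_trans PQ.
Qed.

(** A basic set is a finite intersection of one-seminorm balls, so openness can
    be tested on one seminorm at a time. *)
Lemma induced_open_sub_open Q :
  (forall q e (x : X), Q q -> 0 < e -> open [set y : X | q (y - x) < e]) ->
  induced_open Q `<=` @open X.
Proof.
move=> Qo _ [D DQ <-]; apply: bigcup_open => _ /DQ[F [e [x [Ffin FQ e0 ->]]]].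
have [s Fs] := (finite_seqP _).1 Ffin.
have : forall q, q \in s -> Q q by move=> q qs; apply: FQ; rewrite Fs.
rewrite {}Fs {F Ffin FQ}; elim: s => [_|q s IH sQ].
  by rewrite (_ : asym_ball _ _ _ = setT)//; [exact: openT|exact/seteqP].
rewrite (_ : asym_ball _ _ _ =
    [set y | q (y - x) < e] `&` asym_ball [set` s] e x).
  apply: openI; first by apply: Qo => //; apply: sQ; rewrite mem_head.
  by apply: IH => q' q's; apply: sQ; rewrite inE q's orbT.
apply/seteqP; split=> [y yb|y [yq ys] q' /=].
  by split=> [|q' q's]; apply: yb; rewrite /= inE ?eqxx ?[_ \in _]q's ?orbT.
by rewrite inE => /predU1P[->//|/ys].
Qed.

Context (P : set (X -> R)) (PS : P `<=` @asym_seminorm R X)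
  (openP : @open X = induced_open P).

Lemma open_asym_ball F e x : finite_set F -> F `<=` P -> 0 < e ->
  open (asym_ball F e x).
Proof.
move=> Ffin FP e0; rewrite openP; exists [set asym_ball F e x].
  by move=> _ ->; exists F, e, x.
by rewrite bigcup_set1.
Qed.

Lemma nbhs_asym_ball (U : set X) (y : X) : nbhs y U -> exists F e x,
  [/\ finite_set F, F `<=` P, 0 < e, asym_ball F e x y & asym_ball F e x `<=` U].
Proof.
rewrite nbhsE => -[V [+ Vy] VU]; rewrite openP => -[D DP DV].
move: Vy VU; rewrite -DV => -[B DB By] VU.
have [F [e [x [Ffin FP e0 BE]]]] := DP _ DB.
exists F, e, x; split=> //; rewrite -BE// => z Bz.
by apply: VU; exists B.
Qed.

(** Translations are continuous because translates of basic sets are basic. *)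
Lemma nbhs0_translate (U : set X) (y : X) : nbhs (0 : X) U ->
  nbhs y [set z | U (z - y)].
Proof.
move=> /nbhs_asym_ball[F [e [x [Ffin FP e0 F0 FU]]]].
rewrite nbhsE; exists (asym_ball F e (x + y)).
  split; first exact: open_asym_ball.
  by move=> p /F0; rewrite sub0r opprD addrCA subrr addr0.
by move=> z zF; apply: FU => p /zF; rewrite opprD addrA addrAC.
Qed.

(** A basic set containing the origin need not be centred there: in the
    direction [v] each seminorm [p] has the slack [e - p (- x)], and a finite
    family leaves a positive common step. *)
Lemma nbhs0_absorbing (U : set X) (v : X) : nbhs (0 : X) U ->
  exists2 r : R, 0 < r & U (r *: v).
Proof.
move=> /nbhs_asym_ball[F [e [x [Ffin FP e0 F0 FU]]]].
have [s Fs] := (finite_seqP _).1 Ffin.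
suff [r r0 rs] : exists2 r : R, 0 < r &
    forall p, p \in s -> r * p v < e - p (- x).
  exists r => //; apply: FU => p Fp; have [_ pZ pD] := PS (FP _ Fp).
  apply: le_lt_trans (pD _ _) _; rewrite pZ ?ltW// -ltrBrDr.
  by apply: rs; move: Fp; rewrite Fs.
have : forall p, p \in s -> 0 <= p v /\ p (- x) < e.
  move=> p ps; have Fp : F p by rewrite Fs.
  by have [p0 _ _] := PS (FP _ Fp); have := F0 _ Fp; rewrite sub0r.
elim: s {Fs} => [_|p s IH sP]; first by exists 1.
have [|r r0 rs] := IH; first by move=> q qs; apply: sP; rewrite inE qs orbT.
have [pv0 pxe] := sP p (mem_head _ _).
have t0 : 0 < (e - p (- x)) / (p v + 1) by rewrite divr_gt0//; lra.
(* The [+ 1] keeps the denominator positive when [p v = 0]. *)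
exists (Num.min r ((e - p (- x)) / (p v + 1))); first by rewrite lt_min r0 t0.
move=> q; rewrite inE => /predU1P[->|qs].
  apply: (@le_lt_trans _ _ ((e - p (- x)) / (p v + 1) * p v)).
    by rewrite ler_wpM2r// ge_min lexx orbT.
  by rewrite mulrAC ltr_pdivrMr ?ltr_pM2l; lra.
apply: le_lt_trans (rs q qs).
have [|qv0 _] := sP q; first by rewrite inE qs orbT.
by rewrite ler_wpM2r// ge_min lexx.
Qed.

Lemma equicontinuous_sup_seminorm_fin_num G x :
  asym_equicontinuous G -> sup_seminorm G x \is a fin_num.
Proof.
move=> /(_ 1 ltr01)[U U0 GU]; have [r r0 rxU] := nbhs0_absorbing x U0.
(* [G] is bounded by [1] at [r *: x], hence by [r^-1] at [x]. *)
apply: (@sup_seminorm_fin_num _ _ _ _ r^-1); first by rewrite invr_ge0 ltW.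
move=> phi Gphi; have := GU phi _ Gphi rxU.
by rewrite linearZ/= -ltr_pdivlMl// mulr1 => /ltW.
Qed.

(** Around a point [y] of the ball, the neighbourhood given by equicontinuity
    is translated to [y]; half of the remaining slack keeps the inequality
    strict, since a supremum of values [< d] is only [<= d]. *)
Lemma equicontinuous_open_ball G (e : R) (x : X) : asym_equicontinuous G ->
  0 < e -> open [set y : X | fine (sup_seminorm G (y - x)) < e].
Proof.
move=> Geq e0; have Gfin z := equicontinuous_sup_seminorm_fin_num z Geq.
have [_ _ GD] := asym_seminorm_sup Gfin.
rewrite openE => y /= ye.
have d0 : 0 < (e - fine (sup_seminorm G (y - x))) / 2 by lra.
have [U U0 GU] := Geq _ d0.
apply: filterS (nbhs0_translate y U0) => z /= Uzy.
have := GD (z - y) (y - x); rewrite addrA subrK.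
have : fine (sup_seminorm G (z - y)) <=
    (e - fine (sup_seminorm G (y - x))) / 2.
  apply: fine_sup_seminorm_le; first exact: ltW.
  by move=> phi Gphi; apply/ltW/GU.
lra.
Qed.

(** The functionals dominated by [p] are controlled by the ball of [p] alone:
    this gives both their upper semicontinuity and their equicontinuity. *)
Lemma support_equicontinuous p : P p ->
  equicontinuous_sets X [set phi : {scalar X} | forall x, phi x <= p x].
Proof.
move=> Pp; have p0 : p 0 = 0 by apply/sublinear0/asym_seminorm_sublinear/PS.
have nbhs_ball (e : R) (x : X) : 0 < e -> nbhs x (asym_ball [set p] e x).
  move=> e0; apply: open_nbhs_nbhs; split; last by move=> _ ->; rewrite subrr p0.
  by apply: open_asym_ball => // _ ->.
split=> [phi phip x a|e e0].
- rewrite -subr_gt0 => d0; apply: filterS (nbhs_ball _ x d0) => y.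
  move=> /(_ p erefl) yp; rewrite -(subrK x y) linearD/= -ltrBrDr.
  exact: le_lt_trans (phip _) yp.
- exists (asym_ball [set p] e 0); first exact: nbhs_ball.
  by move=> phi x phip /(_ p erefl); rewrite subr0; exact: le_lt_trans.
Qed.

End InducedTopology.

Theorem theorem3p15 (R : realType) (X : preTopologicalLmodType R)
    (alcX : asym_locally_convex X) (T0X : kolmogorov_space X) :
  (forall G : set {scalar X}, equicontinuous_sets X G ->
     (forall x : X, sup_seminorm G x \is a fin_num) /\
     asym_seminorm (fun x : X => fine (sup_seminorm G x))) /\
  G_open (equicontinuous_sets X) = @open X.
Proof.
have [P PS openP] := alcX; split=> [G [_ Geq]|].
  have Gfin x := equicontinuous_sup_seminorm_fin_num PS openP x Geq.
  by split=> //; exact: asym_seminorm_sup.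
apply/seteqP; split.
- apply: induced_open_sub_open => _ e x [G [_ Geq] <-].
  exact: (equicontinuous_open_ball PS openP).
- rewrite openP; apply: sub_induced_open => p Pp.
  exists [set phi : {scalar X} | forall x, phi x <= p x].
    exact: (support_equicontinuous PS openP).
  exact/sup_seminorm_support/PS.
Qed.
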